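(* Let $F$ be a finite dimensional real vector space and denote by $\mathcal{C}$ the set of all compact convex subsets of $F$ which contain $0$. Denote by $\mathrm{conv}(A\cup B)$ the convex hull of $A\cup B$ for $A,B\in\mathcal{C}$. Consider a map $\phi:\mathcal{C}\to\mathbb{R}$ such that $$\forall A,B\in\mathcal{C},\quad \phi(A+B)=\phi(A)+\phi(B),\qquad \phi(\mathrm{conv}(A\cup B))=\max(\phi(A),\phi(B)),$$ where $A+B$ denotes the Minkowski sum. Then there exists a linear form $\psi\in F^*$ such that $$\forall A\in\mathcal{C},\quad \phi(A)=\max_{t\in A}\psi(t).$$
   Context: $F^*$ is the dual vector space of $F$; the Minkowski sum is $A+B=\{a+b: a\in A,\ b\in B\}$. *)

(* Defs.v *)
From HB Require Import structures.
From mathcomp Require Import all_boot all_order all_algebra.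
From mathcomp Require Import all_classical all_reals all_analysis.

Set Implicit Arguments.
Unset Strict Implicit.
Unset Printing Implicit Defensive.

Import Order.TTheory GRing.Theory Num.Theory VectorInternalTheory.
Import numFieldNormedType.Exports.

Local Open Scope classical_set_scope.
Local Open Scope ring_scope.

(* A finite dimensional real vector space carries a unique Hausdorff vector
   space topology.  The library does not put it on an abstract vectType, so it
   is transported here from 'rV[R]_n along the linear isomorphism v2r. *)
Definition vect_topology (R : realType) (F : vectType R) : topologicalType :=
  initial_topology (v2r : F -> 'rV[R]_(dim F)).

Definition compact_convex0 (R : realType) (F : vectType R) : set (set F) :=
  [set A | [/\ @compact (vect_topology F) A, @convex_set R F A & A 0]].

Definition minkowski_sum (V : nmodType) (A B : set V) : set V :=
  [set a + b | a in A & b in B].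

Definition convex_hull (R : realType) (F : lmodType R) (A : set F) : set F :=
  smallest (@convex_set R F) A.

Definition is_max (R : realType) (S : set R) (m : R) : Prop :=
  S m /\ ubound S m.

(* Main.v *)
(* On segments, set g x = phi [0,x].  The parallelogram [0,x] + [0,y] is the hull
   of its vertices, so g (x + y) <= g x + g y = max (g (x + y), g x, g y); the
   case y = - x says that g x or g (- x) vanishes.  This forces
   psi x = g x - g (- x) to be additive, with g = max (0, psi), and psi is linear
   because it is bounded on segments.  Monotonicity of phi gives psi <= phi A on
   A.  Conversely, cover A by finitely many balls x_i + B_r with x_i in A: A lies
   in the hull of the sets [0,x_i] + B_r, whence phi A <= max_A psi + phi B_r,
   and phi B_r tends to 0 with r by additivity of phi. *)

Require Import Defs.
From HB Require Import structures.
From mathcomp Require Import all_boot all_order all_algebra.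
From mathcomp Require Import all_classical all_reals all_analysis.
From mathcomp Require Import ring lra.

Set Implicit Arguments.
Unset Strict Implicit.
Unset Printing Implicit Defensive.

Import Order.TTheory GRing.Theory Num.Theory VectorInternalTheory.
Import numFieldNormedType.Exports.

Local Open Scope classical_set_scope.
Local Open Scope ring_scope.

(** * Compactness and convexity in coordinates: balls and Minkowski sums *)

Section CompactConvex.
Context (R : realType) (F : vectType R).
Implicit Types (A B : set F) (x y t : F) (r s : R).

Lemma convex_setP (E : lmodType R) (A : set E) :
  convex_set A <->
  (forall (r : R) (x y : E), 0 <= r <= 1 -> A x -> A y ->
     A (r *: x + (1 - r) *: y)).
Proof.
split=> [cA r x y /andP[r0 r1] Ax Ay|cA x y l /set_mem Ax /set_mem Ay].
  by have /set_mem := cA x y (Itv01 r0 r1) (mem_set Ax) (mem_set Ay).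
by apply/mem_set/cA => //; rewrite ge0 le1.
Qed.

Lemma r2v_continuous :
  continuous (@r2v R F : 'rV[R]_(dim F) -> vect_topology F).
Proof.
apply: continuous_comp_initial => v.
by rewrite (_ : _ \o _ = id)//; apply/funext => w /=; rewrite r2vK.
Qed.

(** Moves compactness questions to row vectors, where norms and products are at hand: [v2r] and
    [r2v] are mutually inverse and both continuous. *)
Lemma compact_vectP A :
  @compact (vect_topology F) A <->
  compact [set v2r x | x in A].
Proof.
split=> [cA|cA].
  apply: (@continuous_compact (vect_topology F)) cA.
  by apply: continuous_subspaceT; exact: initial_continuous.
have -> : A = [set (r2v v : F) | v in [set v2r x | x in A]].
  rewrite eqEsubset; split=> [x Ax|_ [_ [x Ax <-] <-]].
    by exists (v2r x); [exists x|rewrite v2rK].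
  by rewrite v2rK.
apply: (@continuous_compact _ (vect_topology F)) cA.
by apply: continuous_subspaceT; exact: r2v_continuous.
Qed.

Definition vball r : set F := [set x | `|v2r x| <= r].

Lemma compact_vball r : @compact (vect_topology F) (vball r).
Proof.
apply/compact_vectP.
have -> : [set v2r x | x in vball r] =
    [set v : 'rV[R]_(dim F) | `|v| <= r].
  rewrite eqEsubset; split=> [_ [x xr <-]//|v vr].
  exists (r2v v); last by rewrite r2vK.
  by rewrite /vball/= r2vK.
apply: bounded_closed_compact.
  exists r; split; first exact: num_real.
  by move=> M rM v /= vr; exact: le_trans vr (ltW rM).
apply: (@preimage_closed _ _ (fun v : 'rV[R]_(dim F) => `|v|) [set z | z <= r]).
  by move=> v _; exact: norm_continuous.
exact: closed_le.
Qed.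

Lemma vball_compact_convex0 r : 0 <= r -> compact_convex0 (vball r).
Proof.
move=> r0; split; first exact: compact_vball.
  apply/convex_setP => s x y /andP[s0 s1] xr yr; rewrite /vball/=.
  rewrite linearD !linearZ/= (le_trans (ler_normD _ _))// !normrZ.
  rewrite ger0_norm// ger0_norm ?subr_ge0//.
  have -> : r = s * r + (1 - s) * r by ring.
  by rewrite lerD// ler_wpM2l// subr_ge0.
by rewrite /vball/= linear0 normr0.
Qed.

(** A point of the large ball is cut in the proportion [r] to [s]; if [r + s = 0], both radii vanish
    and the point is split as [x + 0]. This makes [phi] additive in the radius. *)
Lemma vballD r s : 0 <= r -> 0 <= s ->
  minkowski_sum (vball r) (vball s) = vball (r + s).
Proof.
move=> r0 s0; rewrite eqEsubset; split.
  move=> _ [x xr [y ys <-]]; rewrite /vball/= linearD.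
  exact: le_trans (ler_normD _ _) (lerD _ _).
move=> x xrs.
have [rs0|rs0] := eqVneq (r + s) 0.
  have [-> ->] : r = 0 /\ s = 0 by split; lra.
  by exists x; [move: xrs; rewrite /vball/= rs0|
    exists 0; [rewrite /vball/= linear0 normr0|rewrite addr0]].
have part u : 0 <= u -> vball u ((u / (r + s)) *: x).
  move=> u0; have u0' : 0 <= u / (r + s) by rewrite divr_ge0// addr_ge0.
  rewrite /vball/= linearZ/= normrZ ger0_norm// mulrAC ler_pdivrMr.
    by rewrite ler_wpM2l.
  by rewrite lt_neqAle eq_sym rs0 addr_ge0.
exists ((r / (r + s)) *: x); first exact: part.
exists ((s / (r + s)) *: x); first exact: part.
by rewrite -scalerDl -mulrDl divff// scale1r.
Qed.

Lemma minkowski_sum_compact_convex0 A B :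
  compact_convex0 A -> compact_convex0 B -> compact_convex0 (minkowski_sum A B).
Proof.
move=> [kA /convex_setP cA A0] [kB /convex_setP cB B0]; split.
- apply/compact_vectP.
  move/compact_vectP: kA => kA; move/compact_vectP: kB => kB.
  have -> : [set v2r x | x in minkowski_sum A B] =
      [set p.1 + p.2 | p in [set v2r x | x in A] `*`
                            [set v2r x | x in B]].
    rewrite eqEsubset; split.
      move=> _ [_ [x Ax [y By <-]] <-]; rewrite linearD.
      by exists (v2r x, v2r y) => //;
        split; [exists x|exists y].
    move=> _ [[_ _] [/= [x Ax <-] [y By <-]] <-].
    by exists (x + y); [exists x => //; exists y|rewrite linearD].
  apply: continuous_compact (compact_setX kA kB).
  by apply: continuous_subspaceT => p; apply: cvgD; [exact: cvg_fst|exact: cvg_snd].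
- apply/convex_setP => r _ _ r01 [x Ax [y By <-]] [x' Ax' [y' By' <-]].
  exists (r *: x + (1 - r) *: x'); first exact: cA.
  exists (r *: y + (1 - r) *: y'); first exact: cB.
  by rewrite !scalerDr addrACA.
- by exists 0 => //; exists 0 => //; rewrite addr0.
Qed.

(** * Convex hull of the union of two convex sets *)

Lemma sub_convex_hull A : A `<=` convex_hull A.
Proof. exact: sub_gen_smallest. Qed.

Lemma convex_hull_id A : convex_set A -> convex_hull A = A.
Proof. exact: smallest_id. Qed.

(** One point from each set suffices: a combination of two such combinations regroups into an [A]
    part and a [B] part, and convexity merges each part into a single weighted point. *)
Lemma convex_hullU A B : convex_set A -> convex_set B -> A 0 -> B 0 ->
  convex_hull (A `|` B) =
  [set p.1 *: p.2.1 + (1 - p.1) *: p.2.2 | p in `[0 : R, 1] `*` (A `*` B)].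
Proof.
move=> /convex_setP cA /convex_setP cB A0 B0; rewrite eqEsubset; split.
  apply: smallest_sub => [|x [Ax|Bx]].
  - apply/convex_setP => r u1 u2 /andP[r0 r1].
    move=> [[s [x y]] [/= + [/= Ax By]] <-]; rewrite in_itv => /andP[/= s0 s1].
    move=> [[t [x' y']] [/= + [/= Ax' By']] <-]; rewrite in_itv => /andP[/= t0 t1].
    (* The weights [a] and [b] need not sum to 1, so they are normalized by [a + b]; when this is 0,
       any point of [C] serves. *)
    have mix (C : set F) (a b : R) (u v : F) :
        (forall (r : R) (x y : F), 0 <= r <= 1 -> C x -> C y ->
           C (r *: x + (1 - r) *: y)) ->
        0 <= a -> 0 <= b -> C u -> C v ->
        exists2 w, C w & a *: u + b *: v = (a + b) *: w.
      move=> cC a0 b0 Cu Cv; have [ab0|ab0] := eqVneq (a + b) 0.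
        have [-> ->] : a = 0 /\ b = 0 by split; lra.
        by exists u => //; rewrite addr0 !scale0r addr0.
      have abp : 0 < a + b by rewrite lt_neqAle eq_sym ab0 addr_ge0.
      exists ((a / (a + b)) *: u + (1 - a / (a + b)) *: v).
        by apply: cC => //; rewrite divr_ge0 ?addr_ge0//= ler_pdivrMr// mul1r lerDl.
      rewrite scalerDr !scalerA mulrBr mulr1 mulrCA divff// mulr1.
      by rewrite [a + b - a]addrAC subrr add0r.
    have [w Aw ew] := mix A (r * s) ((1 - r) * t) x x' cA
      ltac:(nra) ltac:(nra) Ax Ax'.
    have [z Bz ez] := mix B (r * (1 - s)) ((1 - r) * (1 - t)) y y' cB
      ltac:(nra) ltac:(nra) By By'.
    exists (r * s + (1 - r) * t, (w, z)) => /=.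
      by split => //=; rewrite in_itv/=; apply/andP; split; nra.
    rewrite -ew (_ : 1 - (r * s + _) = r * (1 - s) + (1 - r) * (1 - t)) -?ez; last by ring.
    by rewrite !scalerDr !scalerA addrACA.
  (* The partner from the other set has weight 0; the origin is available in both sets. *)
  - exists (1, (x, 0)) => /=; first by split => //=; rewrite in_itv/= ler01 lexx.
    by rewrite scale1r scaler0 addr0.
  - exists (0, (0, x)) => /=; first by split => //=; rewrite in_itv/= ler01 lexx.
    by rewrite scale0r subr0 scale1r add0r.
move=> _ [[s [x y]] [/= + [/= Ax By]] <-]; rewrite in_itv => /andP[/= s0 s1].
move=> C [/convex_setP cC ABC]; apply: cC; first by rewrite s0.
- by apply: ABC; left.
- by apply: ABC; right.
Qed.

(** Compactness holds because [convex_hullU] presents the hull as a continuous image of the product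
    of [[0, 1]], [A] and [B]. *)
Lemma convex_hullU_compact_convex0 A B :
  compact_convex0 A -> compact_convex0 B ->
  compact_convex0 (convex_hull (A `|` B)).
Proof.
move=> [kA cA A0] [kB cB B0]; split; last by apply: sub_convex_hull; left.
- rewrite convex_hullU//; apply/compact_vectP.
  move/compact_vectP: kA => kA; move/compact_vectP: kB => kB.
  set A' := image A _ in kA; set B' := image B _ in kB.
  rewrite (_ : image _ _ =
      [set p.1 *: p.2.1 + (1 - p.1) *: p.2.2 | p in `[0 : R, 1] `*` (A' `*` B')]).
    apply: continuous_compact
      (compact_setX (@segment_compact _ _ _) (compact_setX kA kB)).
    apply: continuous_subspaceT => p.
    apply: cvgD; apply: cvgZ.
    + exact: cvg_fst.
    + by apply: (@cvg_comp _ _ _ snd fst); [exact: cvg_snd|exact: cvg_fst].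
    + by apply: cvgB; [exact: cvg_cst|exact: cvg_fst].
    + by apply: (@cvg_comp _ _ _ snd snd); [exact: cvg_snd|exact: cvg_snd].
  rewrite eqEsubset; split.
    move=> _ [_ [[r [x y]] [/= r01 [/= Ax By]] <-] <-].
    exists (r, (v2r x, v2r y)) => /=.
      by split => //; split => /=; [exists x|exists y].
    by rewrite linearD !linearZ.
  move=> _ [[r [_ _]] [/= r01 [/= [x Ax <-] [y By <-]]] <-].
  exists (r *: x + (1 - r) *: y); last by rewrite linearD !linearZ.
  by exists (r, (x, y)).
- apply/convex_setP => r x y r01 Ax Ay C cABC.
  by have [/convex_setP cC _] := cABC; apply: cC => //; [exact: Ax|exact: Ay].
Qed.

(** * Segments issued from the origin *)

Definition vsegment x : set F := [set r *: x | r in `[0 : R, 1]].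

Lemma vsegment_compact_convex0 x : compact_convex0 (vsegment x).
Proof.
split.
- apply/compact_vectP.
  rewrite (_ : image _ _ = [set r *: v2r x | r in `[0 : R, 1]]).
    apply: continuous_compact (@segment_compact _ _ _).
    apply: continuous_subspaceT => r; apply: cvgZr_tmp; exact: cvg_id.
  by rewrite image_comp; apply: eq_imagel => r _ /=; rewrite linearZ.
- apply/convex_setP => r u1 u2 /andP[r0 r1] [s /= s01 <-] [t /= t01 <-].
  move: s01 t01; rewrite !in_itv/= => /andP[s0 s1] /andP[t0 t1].
  exists (r * s + (1 - r) * t); last by rewrite [LHS]scalerDl !scalerA.
  by rewrite /= in_itv/=; apply/andP; split; nra.
- by exists 0; [rewrite /= in_itv/= lexx ler01|rewrite scale0r].
Qed.

Lemma vsegment_end x : vsegment x x.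
Proof. by exists 1; [rewrite /= in_itv/= ler01 lexx|rewrite scale1r]. Qed.

Lemma vsegment_sub x A : convex_set A -> A 0 -> A x -> vsegment x `<=` A.
Proof.
move=> /convex_setP cA A0 Ax _ [r /= + <-]; rewrite in_itv/= => r01.
by have := cA r x 0 r01 Ax A0; rewrite scaler0 addr0.
Qed.

(** * Maxima of linear forms and finite nets on compact sets *)

Lemma linear_rV_continuous n (f : {linear 'rV[R]_n -> R^o}) : continuous f.
Proof.
have -> : f = \sum_(j < n)
    (fun v : 'rV[R]_n => v ord0 j * f (delta_mx ord0 j)) :> (_ -> R^o).
  apply/funext => v; rewrite fct_sumE {1}(row_sum_delta v) linear_sum.
  by apply: eq_bigr => j _; exact: linearZ.
apply: (big_ind (fun g : 'rV[R]_n -> R^o => continuous g)).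
- exact: (@cst_continuous _ _ (0 : R^o)).
- by move=> g h cg ch v; apply: continuousD; [exact: cg|exact: ch].
- move=> j _ v; pose k : R := f (delta_mx ord0 j).
  exact: (continuousM (@coord_continuous R 1 n ord0 j v) (@cst_continuous _ _ k v)).
Qed.

Lemma linear_max (f : {linear F -> R^o}) A :
  @compact (vect_topology F) A -> A !=set0 ->
  exists2 c, A c & forall x, A x -> f x <= f c.
Proof.
move=> /compact_vectP kA [a Aa].
have kf := @linear_rV_continuous _
  (f \o (@r2v R F) : {linear _ -> R^o}).
have [] := compact_EVT_max (f := f \o @r2v R F) _ kA.
- by exists (v2r a); exists a.
- exact: continuous_subspaceT.
move=> _ /set_mem[c Ac <-] fc; exists c => // x Ax.
have := fc (v2r x).
rewrite /= !v2rK; apply.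
by apply/mem_set; exists x.
Qed.

Lemma compact_vect_net A r : @compact (vect_topology F) A -> 0 < r ->
  exists l : seq F, (forall x, x \in l -> A x) /\
    forall t, A t -> exists2 x, x \in l & vball r (t - x).
Proof.
move=> /compact_vectP + r0; rewrite compact_cover.
move=> /(_ _ [set v2r x | x in A]
  (fun v => ball v r)) [].
- by move=> v _; exact: ball_open.
- by move=> v Av; exists v => //; exact: ballxx.
move=> D DA AD; exists [seq r2v v | v <- finmap.enum_fset D]; split.
  move=> _ /mapP[v vD ->]; have /set_mem[x Ax <-] := DA _ vD.
  by rewrite v2rK.
move=> t At; have [|v vD] := AD (v2r t); first by exists t.
rewrite -ball_normE/= => vt.
exists (r2v v); first exact: map_f.
by rewrite /vball/= linearB/= r2vK distrC ltW.
Qed.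

End CompactConvex.

Arguments vball {R} F r.
Arguments vball_compact_convex0 {R} F {r}.

(** * Two criteria for additivity and homogeneity *)

Lemma additive_bounded_scalable (R : realType) (V : lmodType R)
    (f : {additive V -> R}) :
  (forall x, exists C, forall t, 0 <= t <= 1 -> `|f (t *: x)| <= C) ->
  forall t x, f (t *: x) = t * f x.
Proof.
move=> fb t x; have [C fC] := fb x.
(* The defect [h] is additive and vanishes at 1, hence on integers. It is thus 1-periodic, so its
   bound on [[0, 1]] holds everywhere, and a bounded additive function is zero. *)
pose h t := f (t *: x) - t * f x.
have hB : zmod_morphism h.
  by move=> u v; rewrite /h scalerBl raddfB mulrBl; lra.
pose H : {additive R -> R} :=
  HB.pack h (GRing.isZmodMorphism.Build _ _ h hB).
have h1 : h 1 = 0 by rewrite /h scale1r mul1r subrr.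
have hz m : H m%:~R = 0.
  by rewrite (raddfMz H m 1) -[X in X *~ _]/(h 1) h1 mul0rz.
have hC u : `|H u| <= C + `|f x|.
  rewrite -(subrK (Num.floor u)%:~R u) raddfD hz addr0.
  have /andP[u0 u1] : 0 <= u - (Num.floor u)%:~R <= 1.
    rewrite subr_ge0 ge_floor/= lerBlDl ltW// -intrD1 floorD1_gt//.
  set w := u - _ in u0 u1 *; rewrite /= /h (le_trans (ler_normB _ _))//.
  rewrite lerD ?fC ?u0// normrM ger0_norm// ler_piMl//.
apply/eqP; rewrite -subr_eq0 -[_ - _]/(H t) -normr_eq0; apply/negPn/negP => Ht.
have Htp : 0 < `|H t| by rewrite lt_neqAle eq_sym Ht normr_ge0.
(* This multiple of [t] is large enough for the value of [H] there to exceed the uniform bound. *)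
have := hC (t *+ (Num.truncn ((C + `|f x|) / `|H t|)).+1).
rewrite raddfMn normrMn -mulr_natl -ler_pdivlMr// leNgt => /negP[].
exact: truncnS_gt.
Qed.

(** With [z = - (x + y)] the claim becomes symmetric: the differences [g u - g (- u)] for [u] among
    [x], [y], [z] sum to 0. The sum of any two of these vectors is the opposite of the third, so the
    hypotheses become inequalities between six numbers. *)
Lemma pos_part_additive (R : realType) (V : zmodType) (g : V -> R) :
  (forall x, 0 <= g x) ->
  (forall x, g x = 0 \/ g (- x) = 0) ->
  (forall x y, g (x + y) <= g x + g y) ->
  (forall x y, g x + g y <= Num.max (g (x + y)) (Num.max (g x) (g y))) ->
  zmod_morphism (fun x => g x - g (- x)).
Proof.
move=> g_ge0 g_oppr g_subadd g_vertex x y'.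
have [y ->] : exists y, y' = - y by exists (- y'); rewrite opprK.
rewrite !opprK; set z := - (x + y).
have exy : x + y = - z by rewrite opprK.
have exz : x + z = - y by rewrite /z opprD addrA subrr add0r.
have eyz : y + z = - x by rewrite /z opprD addrCA subrr addr0.
have nxy : - x + - y = z by rewrite -opprD.
have nxz : - x + - z = y by rewrite -opprD exz opprK.
have nyz : - y + - z = x by rewrite -opprD eyz opprK.
have := (g_subadd x y, g_subadd x z, g_subadd y z).
have := (g_subadd (- x) (- y), g_subadd (- x) (- z), g_subadd (- y) (- z)).
have := (g_vertex x y, g_vertex x z, g_vertex y z).
have := (g_vertex (- x) (- y), g_vertex (- x) (- z), g_vertex (- y) (- z)).
rewrite exy exz eyz nxy nxz nyz.
have := (g_ge0 x, g_ge0 y, g_ge0 z, g_ge0 (- x), g_ge0 (- y), g_ge0 (- z)).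
move: (g x) (g y) (g z) (g (- x)) (g (- y)) (g (- z)) (g_oppr x) (g_oppr y) (g_oppr z).
move=> a b c a' b' c' ha hb hc [[[[[? ?] ?] ?] ?] ?] [[+ +] +] [[+ +] +].
move=> H1 H2 H3 H4 H5 H6 [[? ?] ?] [[? ?] ?].
move: H1 H2 H3 H4 H5 H6; rewrite !le_max => H1 H2 H3 H4 H5 H6.
(* Eight cases say which of [g u], [g (- u)] vanishes; in each, splitting at most one of the six
   maxima leaves linear arithmetic. *)
by case: ha => ?; case: hb => ?; case: hc => ?; first
  [ lra | case/or3P: H1 => ?; lra | case/or3P: H2 => ?; lra
  | case/or3P: H3 => ?; lra | case/or3P: H4 => ?; lra
  | case/or3P: H5 => ?; lra | case/or3P: H6 => ?; lra ].
Qed.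

(** * The valuation on segments and the linear form it defines *)

Section Valuation.
Context (R : realType) (F : vectType R) (phi : set F -> R).
Context (phiD : forall A B : set F, compact_convex0 A -> compact_convex0 B ->
  phi (minkowski_sum A B) = phi A + phi B).
Context (phiU : forall A B : set F, compact_convex0 A -> compact_convex0 B ->
  phi (convex_hull (A `|` B)) = Num.max (phi A) (phi B)).

(** The hull of the union is then [B] itself, so [phiU] reads [phi B = Num.max (phi A) (phi B)]. *)
Lemma valuation_mono (A B : set F) : compact_convex0 A -> compact_convex0 B ->
  A `<=` B -> phi A <= phi B.
Proof.
move=> cA cB AB; have [_ vB _] := cB.
by have := phiU cA cB; rewrite (setUidr AB) convex_hull_id// => ->; rewrite le_max lexx.
Qed.

Let g (x : F) := phi (vsegment x).

Let g_le (A : set F) x : compact_convex0 A -> A x -> g x <= phi A.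
Proof.
move=> cA Ax; have [_ vA A0] := cA; apply: valuation_mono => //.
  exact: vsegment_compact_convex0.
exact: vsegment_sub.
Qed.

Let vsegment0 : vsegment (0 : F) = [set 0].
Proof.
rewrite eqEsubset; split=> [_ [r _ <-]|_ ->]; first by rewrite scaler0.
exact: vsegment_end.
Qed.

Let g0 : g 0 = 0.
Proof.
have c0 := vsegment_compact_convex0 (0 : F).
have := phiD c0 c0; rewrite (_ : minkowski_sum _ _ = vsegment 0).
  by rewrite -/(g 0); lra.
rewrite vsegment0 eqEsubset; split=> [_ [_ -> [_ -> <-]]|_ ->].
  by rewrite addr0.
by exists 0 => //; exists 0 => //; rewrite addr0.
Qed.

Let phi_ge0 (A : set F) : compact_convex0 A -> 0 <= phi A.
Proof. by move=> cA; rewrite -g0; apply: g_le => //; have [] := cA. Qed.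

Let g_ge0 x : 0 <= g x.
Proof. exact/phi_ge0/vsegment_compact_convex0. Qed.

Let segD x y : phi (minkowski_sum (vsegment x) (vsegment y)) = g x + g y.
Proof. by apply: phiD; exact: vsegment_compact_convex0. Qed.

Let segD_cc x y :
  compact_convex0 (minkowski_sum (vsegment x) (vsegment y) : set F).
Proof. by apply: minkowski_sum_compact_convex0; exact: vsegment_compact_convex0. Qed.

Let g_subadd x y : g (x + y) <= g x + g y.
Proof.
rewrite -segD; apply: g_le => //.
by exists x; [exact: vsegment_end|exists y; [exact: vsegment_end|]].
Qed.

(* The parallelogram [0,x] + [0,y] lies in the hull of its four vertices. *)
Let g_vertex x y : g x + g y <= Num.max (g (x + y)) (Num.max (g x) (g y)).
Proof.
have cx := vsegment_compact_convex0 x; have cy := vsegment_compact_convex0 y.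
have cxy := vsegment_compact_convex0 (x + y).
have cU := convex_hullU_compact_convex0 cx cy.
rewrite -phiU// -phiU// -segD; apply: valuation_mono => //.
  exact: convex_hullU_compact_convex0.
set H := convex_hull _.
have [_ /convex_setP vH H0] : compact_convex0 H by exact: convex_hullU_compact_convex0.
have Hx : H x.
  by apply: sub_convex_hull; right; apply: sub_convex_hull; left; exact: vsegment_end.
have Hy : H y.
  by apply: sub_convex_hull; right; apply: sub_convex_hull; right; exact: vsegment_end.
have Hxy : H (x + y) by apply: sub_convex_hull; left; exact: vsegment_end.
move=> _ [_ [r /= + <-] [_ [s /= + <-] <-]]; rewrite !in_itv/= => r01 s01.
(* Two opposite edges first: [r *: x] lies on the edge from 0 to [x], and [r *: x + y] on the edge
   from [y] to [x + y]. The parameter [s] then interpolates between them. *)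
have Hr : H (r *: x) by have := vH r x 0 r01 Hx H0; rewrite scaler0 addr0.
have Hry : H (r *: x + y).
  have := vH r (x + y) y r01 Hxy Hy.
  by rewrite scalerDr -addrA -scalerDl subrKC scale1r.
have := vH s (r *: x + y) (r *: x) s01 Hry Hr.
by rewrite scalerDr addrAC -scalerDl subrKC scale1r.
Qed.

Let g_oppr x : g x = 0 \/ g (- x) = 0.
Proof.
have := g_vertex x (- x); rewrite subrr g0.
have := g_ge0 x; have := g_ge0 (- x); rewrite !maxElt.
by case: ltP => ?; case: ltP => ? ? ?; lra.
Qed.

Let psi x := g x - g (- x).

Let g_psi x : g x = Num.max 0 (psi x).
Proof.
rewrite /psi maxElt; have := g_ge0 x; have := g_ge0 (- x).
by case: (g_oppr x) => ->; case: ltP; lra.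
Qed.



Let psi_morphism : zmod_morphism psi.
Proof. exact: pos_part_additive. Qed.

Let psiA : {additive F -> R} :=
  HB.pack psi (GRing.isZmodMorphism.Build _ _ psi psi_morphism).

Let psi_scalable : scalable (psi : F -> R^o).
Proof.
apply: (additive_bounded_scalable (f := psiA)) => x.
(* For [t] in [[0, 1]] the segment to [t *: x] is contained in the one to [x], and likewise for
   [- x]. *)
exists (g x + g (- x)) => t t01.
have gt y : g (t *: y) <= g y.
  apply: g_le; first exact: vsegment_compact_convex0.
  by exists t => //; rewrite /= in_itv.
have := (gt x, gt (- x), g_ge0 (t *: x), g_ge0 (t *: - x)).
rewrite /= /psi -scalerN ler_norml => -[[[? ?] ?] ?].
by apply/andP; split; lra.
Qed.

Let psiL : {linear F -> R^o} :=
  HB.pack (psi : F -> R^o)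
    (GRing.isZmodMorphism.Build _ _ (psi : F -> R^o) psi_morphism)
    (GRing.isScalable.Build _ _ _ _ (psi : F -> R^o) psi_scalable).

(** * Approximation by hulls of thickened segments *)

Lemma valuation_bound (l : seq F) (r M : R) : 0 <= r -> 0 <= M ->
  (forall x, x \in l -> g x <= M) ->
  exists P : set F, [/\ compact_convex0 P, phi P <= M + phi (vball F r) &
    forall x y : F, x \in l -> vball F r y -> P (x + y)].
Proof.
move=> r0 M0; have cB := vball_compact_convex0 F r0.
elim: l => [_|a l IH lM].
  (* With no centre the ball alone will do, since [0 <= M]. *)
  by exists (vball F r); split; rewrite // lerDr.
have [|P [cP PM lP]] := IH; first by move=> x xl; rewrite lM// inE xl orbT.
have ca := vsegment_compact_convex0 a.
have cQ := minkowski_sum_compact_convex0 ca cB.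
(* Each new centre enters through a maximum, not a sum, so the error stays [phi (vball F r)]
   whatever the length of [l]. *)
exists (convex_hull (P `|` minkowski_sum (vsegment a) (vball F r))); split.
- exact: convex_hullU_compact_convex0.
- by rewrite phiU// ge_max PM phiD// lerD2r lM// inE eqxx.
- move=> x y; rewrite inE => /orP[/eqP ->|xl] ry.
    apply: sub_convex_hull; right.
    by exists a; [exact: vsegment_end|exists y].
  by apply: sub_convex_hull; left; exact: lP.
Qed.

Lemma valuation_ballMn r n : 0 <= r -> phi (vball F (r *+ n)) = phi (vball F r) *+ n.
Proof.
move=> r0; elim: n => [|n IH].
  (* The ball of radius 0 is its own Minkowski double, so its value is 0. *)
  have c0 := vball_compact_convex0 F (lexx 0).
  have := phiD c0 c0; rewrite vballD// addr0 mulr0n.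
  by move=> /eqP; rewrite -subr_eq subrr eq_sym => /eqP.
rewrite !mulrS -vballD ?mulrn_wge0// phiD ?IH//;
  by apply: vball_compact_convex0; rewrite ?mulrn_wge0.
Qed.

Lemma valuation_ball_small (e : R) : 0 < e ->
  exists2 r : R, 0 < r & phi (vball F r) < e.
Proof.
(* The unit ball is the sum of [n] balls of radius [n%:R^-1], each of value
   [phi (vball F 1) / n%:R]; this [n] makes that value less than [e]. *)
move=> e0; pose n := (Num.truncn (phi (vball F 1) / e)).+1.
exists n%:R^-1; first by rewrite invr_gt0.
have n0 : 0 < n%:R :> R by rewrite ltr0n.
have : phi (vball F 1) / e < n%:R by exact: truncnS_gt.
rewrite -{1}(mulVf (lt0r_neq0 n0)) [_^-1 * _]mulr_natr.
rewrite valuation_ballMn ?invr_ge0 ?ltW// -[phi _ *+ n]mulr_natr mulrAC gtr_pMl//.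
by rewrite ltr_pdivrMr// mul1r.
Qed.

Lemma valuation_support : exists psi : {linear F -> R^o},
  forall A, compact_convex0 A -> is_max [set psi t | t in A] (phi A).
Proof.
exists psiL => A cA; have [kA _ A0] := cA.
have [|c Ac cmax] := linear_max psiL kA; first by exists 0.
have ub : ubound [set psiL t | t in A] (phi A).
  move=> _ [t At <-]; apply: le_trans (g_le cA At).
  by rewrite g_psi le_max lexx orbT.
split=> //; exists c => //; apply/eqP; rewrite eq_le ub/=; last by exists c.
apply/ler_addgt0Pr => e e0.
have [r r0 re] := valuation_ball_small e0.
have [l [lA Al]] := compact_vect_net kA r0.
(* Since [A] contains 0, the maximum [psi c] is nonnegative. It therefore bounds the positive part
   [g] of [psi] on [A] and can serve as [M]. *)
have psic0 : 0 <= psi c by have := cmax 0 A0; rewrite linear0.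
have lM x : x \in l -> g x <= psi c.
  by move=> /lA Ax; rewrite g_psi ge_max psic0; exact: cmax.
have [P [cP PM lP]] := valuation_bound (ltW r0) psic0 lM.
apply: le_trans (valuation_mono cA cP _) (le_trans PM _).
  (* [A] lies in [P]: each [t] is a centre [x] of the net plus the vector [t - x] of the small
     ball. *)
  by move=> t /Al[x xl tx]; rewrite -(subrKC x t); exact: lP.
by rewrite lerD2l ltW.
Qed.

End Valuation.

Theorem theorem7 (R : realType) (F : vectType R) (phi : set F -> R)
  (phiD : forall A B : set F, compact_convex0 A -> compact_convex0 B ->
    phi (minkowski_sum A B) = phi A + phi B)
  (phiU : forall A B : set F, compact_convex0 A -> compact_convex0 B ->
    phi (convex_hull (A `|` B)) = Num.max (phi A) (phi B)) :
  exists psi : 'Hom(F, R^o),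
    forall A : set F, compact_convex0 A ->
      is_max [set psi t | t in A] (phi A).
Proof.
have [psi psiP] := valuation_support phiD phiU.
exists (linfun psi) => A /psiP; rewrite (_ : image A (linfun psi) = image A psi)//.
by apply: eq_imagel => t _; rewrite lfunE.
Qed.
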